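(* Let $A,B,C$ be real constants with $B\neq 0$, let $I\subseteq\mathbb{R}$ be an open interval, and let $W_{\mathcal{LT}}:I\to\mathbb{R}$ be a differentiable function such that for every $x\in I$ we have $B\,W_{\mathcal{LT}}(x)>0$ and $$\bigl(A\,W_{\mathcal{LT}}(x)\ln(B\,W_{\mathcal{LT}}(x))+W_{\mathcal{LT}}(x)+C\bigr)e^{W_{\mathcal{LT}}(x)}=x .$$ Then for every $x\in I$, $$\frac{dW_{\mathcal{LT}}(x)}{dx}=\frac{e^{-W_{\mathcal{LT}}(x)}}{[W_{\mathcal{LT}}(x)+1]\,A\ln\bigl(BW_{\mathcal{LT}}(x)\bigr)+W_{\mathcal{LT}}(x)+A+C+1}.$$
   Context: For real constants $A,B,C$, the translated logarithmic Lambert function $W_{\mathcal{LT}}(x)$ is defined as a solution $y$ (necessarily with $By>0$, so $y\neq0$) of the equation $(Ay\ln(By)+y+C)e^y=x$. *)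

(* Defs.v *)
From Stdlib Require Export Reals.
From Coquelicot Require Export Coquelicot.

(* Main.v *)
Require Import Defs.
From Stdlib Require Import Reals Lra.
From Coquelicot Require Import Coquelicot.
Open Scope R_scope.

Lemma Derive_right_inverse_loc (f g : R -> R) (x df : R) :
  is_derive f (g x) df -> ex_derive g x ->
  locally x (fun t => f (g t) = t) ->
  df <> 0 /\ Derive g x = / df.
Proof.
  intros hf hg hfg.
  assert (hchain : Derive (fun t => f (g t)) x = Derive g x * df).
  { apply is_derive_unique, (is_derive_comp f g); [exact hf |].
    now apply Derive_correct. }
  assert (hprod : Derive g x * df = 1).
  { rewrite <- hchain, <- (Derive_id x).
    now apply Derive_ext_loc. }
  assert (hdf : df <> 0) by (intros ->; lra).
  split; [exact hdf |].
  apply (Rmult_eq_reg_r df); [| exact hdf].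
  now rewrite hprod, Rinv_l.
Qed.

Definition translated_log_lambert_inv (A B C y : R) : R :=
  (A * y * ln (B * y) + y + C) * exp y.

Lemma is_derive_translated_log_lambert_inv (A B C y : R) :
  0 < B * y ->
  is_derive (translated_log_lambert_inv A B C) y
    (((y + 1) * A * ln (B * y) + y + A + C + 1) * exp y).
Proof.
  intros hBy.
  assert (hB : B <> 0) by (intros ->; lra).
  assert (hy : y <> 0) by (intros ->; lra).
  unfold translated_log_lambert_inv.
  auto_derive; [exact hBy | now field].
Qed.

Theorem theorem1 (A B C : R) (hB : B <> 0) (a b : Rbar) (W : R -> R)
    (hdiff : forall x : R, Rbar_lt a x -> Rbar_lt x b -> ex_derive W x)
    (hpos : forall x : R, Rbar_lt a x -> Rbar_lt x b -> 0 < B * W x)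
    (heq : forall x : R, Rbar_lt a x -> Rbar_lt x b ->
      (A * W x * ln (B * W x) + W x + C) * exp (W x) = x) :
  forall x : R, Rbar_lt a x -> Rbar_lt x b ->
    (W x + 1) * A * ln (B * W x) + W x + A + C + 1 <> 0 /\
    Derive W x =
      exp (- W x) / ((W x + 1) * A * ln (B * W x) + W x + A + C + 1).
Proof.
  intros x hax hxb.
  assert (hinv : locally x (fun t => translated_log_lambert_inv A B C (W t) = t))
    by exact (locally_interval _ x a b hax hxb heq).
  destruct (Derive_right_inverse_loc _ W x _
    (is_derive_translated_log_lambert_inv A B C (W x) (hpos x hax hxb))
    (hdiff x hax hxb) hinv) as [hslope hderiv].
  apply Rmult_neq_0_reg in hslope as [hdenom _].
  split; [exact hdenom |].
  rewrite hderiv, Rinv_mult, exp_Ropp.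
  apply Rmult_comm.
Qed.
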